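(* Let $\mathcal P\subset\mathbb R^n$ be an $n$-dimensional convex polytope and consider $\dot x=Ax+a+Bu$, $x\in\mathcal P$, with $A\in\mathbb R^{n\times n}$, $a\in\mathbb R^n$, $B\in\mathbb R^{n\times m}$. Assume (A1) $\operatorname{rank}(B)=n-1$; (A2) $(A,B)$ is controllable; (A3) $\operatorname{int}\mathcal P\cap\mathcal O=\emptyset$; (A4) $\mathcal F$ is an $(n-1)$-dimensional polytope contained in the boundary of $\mathcal P$. Then $\mathcal P\xrightarrow{\mathcal P}\mathcal F$ if and only if (a) $\mathcal H^-\setminus(\mathcal F\cup\mathcal B^-)=\emptyset$, and (b) $\mathcal P^+\not\subset \mathcal O\cap\{x\in\mathcal P:\beta^Tx>\beta^Tv^+\}$.
   Context: Controls $u:t\mapsto u(t)\in\mathbb R^m$ are piecewise continuous; $\phi^u_t(x_0)$ denotes the solution from $x_0$. For closed sets $\Omega,\Omega_f$ and $x\in\Omega$, $x\xrightarrow{\Omega}\Omega_f$ means there exist a piecewise continuous control $u$ and $T\ge 0$ with $\phi^u_T(x)\in\Omega_f$ and $\phi^u_t(x)\in\Omega$ for all $t\in[0,T]$; for a set $\Omega'\subseteq\Omega$, $\Omega'\xrightarrow{\Omega}\Omega_f$ means $x\xrightarrow{\Omega}\Omega_f$ for every $x\in\Omega'$. Let $\mathcal B=\operatorname{Im}(B)$ and $\mathcal O=\{x\in\mathbb R^n: Ax+a\in\mathcal B\}$. Let $\beta$ be the unit normal vector to $\mathcal B$ such that $\beta^T(Ax+a)\le 0$ for all $x\in\mathcal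 P$. For $z\in\mathbb R^n$ let $\mathcal B_z=\{x\in\mathbb R^n:\beta^Tx=\beta^Tz\}$. Let $v^-\in\arg\min\{\beta^Tx:x\in\mathcal F\}$, $v^+\in\arg\max\{\beta^Tx:x\in\mathcal F\}$, $\mathcal H^-=\{x\in\mathcal P:\beta^Tx\le\beta^Tv^-\}$, $\mathcal P^+=\arg\max\{\beta^Tx:x\in\mathcal P\}$, and $\mathcal B^-=\mathcal B_{v^-}\cap\mathcal O$ if $\mathcal B_{v^-}\cap\mathcal O\cap\mathcal F\neq\emptyset$, and $\mathcal B^-=\emptyset$ otherwise. *)

(* Defs.v *)
From HB Require Import structures.
From mathcomp Require Import all_boot all_order all_algebra.
From mathcomp Require Import all_classical all_reals all_analysis.
Set Implicit Arguments. Unset Strict Implicit. Unset Printing Implicit Defensive.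
Import Order.TTheory GRing.Theory Num.Theory.
Import numFieldNormedType.Exports.
Local Open Scope classical_set_scope.
Local Open Scope ring_scope.

Section Defs.
Variable R : realType.

Definition bdot n (b x : 'cV[R]_n) : R := \sum_(i < n) b i 0 * x i 0.

Definition conv n (V : seq 'cV[R]_n) : set 'cV[R]_n :=
  [set x | exists w : 'I_(size V) -> R,
     (forall i, 0 <= w i) /\ \sum_(i < size V) w i = 1 /\
     x = \sum_(i < size V) w i *: V`_i].

Definition aff_dim n (V : seq 'cV[R]_n) : nat :=
  \rank (\matrix_(i < size V) (V`_i - V`_0)^T).

Definition is_polytope n (S : set 'cV[R]_n) (d : nat) : Prop :=
  exists V : seq 'cV[R]_n, V <> [::] /\ S = conv V /\ aff_dim V = d.

Definition Im_mx n m (B : 'M[R]_(n, m)) : set 'cV[R]_n :=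
  [set y | exists u : 'cV[R]_m, y = B *m u].

Definition Oset n m (A : 'M[R]_n) (a : 'cV[R]_n) (B : 'M[R]_(n, m)) : set 'cV[R]_n :=
  [set x | Im_mx B (A *m x + a)].

Definition controllable n m (A : 'M[R]_n) (B : 'M[R]_(n, m)) : Prop :=
  \rank (\mxrow_(k < n) (A ^+ k *m B)) = n.

(* x ->^Omega Omegaf : there are a piecewise continuous control u on [0,T]
   (with partition 0 = t_0 < ... < t_k = T, u continuous on each open piece
   with continuous extension to the closed piece) and the corresponding
   solution phi of  phi' = A phi + a + B u, phi 0 = x  (continuous on [0,T],
   satisfying the ODE on each open piece), staying in Omega on [0,T] and
   ending in Omegaf at time T. *)
Definition reach n m (A : 'M[R]_n) (a : 'cV[R]_n) (B : 'M[R]_(n, m))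
  (Omega Omegaf : set 'cV[R]_n) (x : 'cV[R]_n) : Prop :=
  exists (T : R) (u : R -> 'cV[R]_m) (phi : R -> 'cV[R]_n)
         (k : nat) (t : nat -> R),
    [/\ 0 <= T /\ t 0%N = 0, t k = T,
        (forall i, (i < k)%N -> t i < t i.+1),
        (forall i, (i < k)%N -> exists g : R -> 'cV[R]_m,
            {within `[t i, t i.+1], continuous g} /\
            (forall s, t i < s < t i.+1 -> g s = u s)) &
     [/\ phi 0 = x,
         {within `[0, T], continuous phi},
         (forall i s, (i < k)%N -> t i < s < t i.+1 ->
            is_derive s 1 phi (A *m phi s + a + B *m u s)),
         (forall s, 0 <= s <= T -> Omega (phi s)) &
         Omegaf (phi T)]].

Definition reach_set n m (A : 'M[R]_n) (a : 'cV[R]_n) (B : 'M[R]_(n, m))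
  (Omega' Omega Omegaf : set 'cV[R]_n) : Prop :=
  forall x, Omega' x -> reach A a B Omega Omegaf x.

End Defs.

(* Main.v *)
(**
Measure a point by its height [bdot beta x]. Since [beta] spans the orthogonal
of [Im B], the control moves the state freely inside the level sets of the
height, while the height itself evolves with the uncontrolled speed
[drift x = bdot beta (A x + a)], which is nonpositive on [P] and vanishes
exactly on [O].

Necessity: the height is nonincreasing, so a trajectory from [H^-] to [F] has
constant height and runs inside [O]; and on a polytope whose top face lies in
[O] the drift is at most proportional to the distance in height to that face,
so by Gronwall's inequality the top face is invariant.

Sufficiency: a curve in [P] is a trajectory as soon as its height has derivative
[drift]. Between two points with negative drift a descending segment can be
reparametrized in this way. A point of [O] is left along a parabola towards a
point of its level with negative drift, and it is reached from above by the
reversed curve; inside [O], any segment of constant height is a trajectory.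
Controllability says that [O] is not a level set of the height.
*)

Require Import Defs.
From HB Require Import structures.
From mathcomp Require Import all_boot all_order all_algebra.
From mathcomp Require Import all_classical all_reals all_analysis.
From mathcomp Require Import ring lra.
Import Order.TTheory GRing.Theory Num.Theory.
Import numFieldNormedType.Exports.
Local Open Scope classical_set_scope.
Local Open Scope ring_scope.
Set Implicit Arguments. Unset Strict Implicit.

(** * The pairing [bdot] as a linear form *)

Section Bdot.
Context {R : realType} {n : nat}.
Implicit Types b g x y : 'cV[R]_n.

Lemma bdotE b x : bdot b x = (b^T *m x) 0 0.
Proof. by rewrite /bdot mxE; apply: eq_bigr => i _; rewrite mxE. Qed.

Lemma bdot_scalar b : scalar (bdot b).
Proof. by move=> k x y; rewrite !bdotE mulmxDr -scalemxAr !mxE. Qed.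

HB.instance Definition _ b :=
  GRing.isLinear.Build R 'cV[R]_n R _ (bdot b) (bdot_scalar b).

Lemma bdotD b x y : bdot b (x + y) = bdot b x + bdot b y.
Proof. exact: linearD. Qed.

Lemma bdotN b x : bdot b (- x) = - bdot b x.
Proof. exact: linearN. Qed.

Lemma bdotB b x y : bdot b (x - y) = bdot b x - bdot b y.
Proof. exact: linearB. Qed.

Lemma bdotZ b (k : R) x : bdot b (k *: x) = k * bdot b x.
Proof. exact: linearZ. Qed.

Lemma bdotC b x : bdot b x = bdot x b.
Proof. by apply: eq_bigr => i _; rewrite mulrC. Qed.

Lemma bdot_mulmx b (A : 'M[R]_n) x : bdot b (A *m x) = bdot (A^T *m b) x.
Proof. by rewrite !bdotE trmx_mul trmxK mulmxA. Qed.

Lemma bdot_eq0P b x : b^T *m x = 0 <-> bdot b x = 0.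
Proof.
rewrite bdotE; split=> [->|bx0]; first by rewrite mxE.
by apply/matrixP => i j; rewrite !ord1 bx0 mxE.
Qed.

End Bdot.

(** * The hyperplane [Im B] and its unit normal *)

Section Hypersurface.
Context {R : realType} {n m : nat}.
Variables (A : 'M[R]_n) (B : 'M[R]_(n, m)) (beta : 'cV[R]_n).
Hypotheses (rankB : (\rank B).+1 = n) (beta1 : bdot beta beta = 1)
  (betaB : forall y, Im_mx B y -> bdot beta y = 0).

Lemma normal_neq0 : beta != 0.
Proof.
apply/eqP => b0; move: beta1; rewrite b0 linear0 => /esym/eqP.
by rewrite oner_eq0.
Qed.

Lemma normal_mulmx : beta^T *m B = 0.
Proof.
apply/matrixP => i j; rewrite ord1 [RHS]mxE.
have <- : bdot beta (col j B) = (beta^T *m B) 0 j.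
  by rewrite bdotE colE mulmxA -colE mxE.
by apply: betaB; exists (delta_mx j 0); rewrite colE.
Qed.

(* A right inverse of [B] on [Im B = beta^perp]. *)
Definition Bpinv : 'M[R]_(m, n) := (pinvmx B^T)^T.

(** [Im B] lies in the orthogonal of [beta] and both have dimension [n - 1], so they coincide. *)
Lemma mul_Bpinv v : bdot beta v = 0 -> B *m (Bpinv *m v) = v.
Proof.
move=> bv0; suff vB : (v^T <= B^T)%MS.
  by apply: trmx_inj; rewrite !trmx_mul trmxK mulmxKpV.
have BK : (B^T <= kermx beta)%MS.
  by apply/sub_kermxP; rewrite -[LHS]trmxK trmx_mul trmxK normal_mulmx trmx0.
have KB : (kermx beta <= B^T)%MS.
  rewrite -(geq_leqif (mxrank_leqif_sup BK)) mxrank_ker mxrank_tr.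
  rewrite -mxrank_tr rank_rV.
  have -> : beta^T != 0 by rewrite -trmx0 (inj_eq trmx_inj) normal_neq0.
  by rewrite -[in X in (X - _)%N]rankB subn1.
apply: submx_trans KB; apply/sub_kermxP/trmx_inj.
by rewrite trmx_mul trmxK trmx0; apply/bdot_eq0P.
Qed.

Lemma Im_mxP v : Im_mx B v <-> bdot beta v = 0.
Proof.
split; first exact: betaB.
by move=> /mul_Bpinv bv; exists (Bpinv *m v).
Qed.

(** If [beta] were an eigenvector of [A^T], then [beta^T *m A ^+ k *m B] would vanish for all [k],
    and a nonzero row would annihilate the controllability matrix, which has full row rank. *)
Lemma controllable_normal (lam : R) :
  controllable A B -> A^T *m beta <> lam *: beta.
Proof.
move=> ctr eqA; have eqAt : beta^T *m A = lam *: beta^T.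
  by apply: trmx_inj; rewrite trmx_mul trmxK eqA linearZ /= trmxK.
have eqAk k : beta^T *m A ^+ k = lam ^+ k *: beta^T.
  elim: k => [|k IHk]; first by rewrite expr0 mulmx1 expr0 scale1r.
  by rewrite exprS -mulmxE mulmxA eqAt -scalemxAl IHk scalerA -exprS.
have : beta^T *m \mxrow_(k < n) (A ^+ k *m B) = 0.
  rewrite mul_mxrow -mxrow0; apply/eq_mxrowP => k.
  by rewrite mulmxA eqAk -scalemxAl normal_mulmx scaler0.
move/eqP; rewrite mulmx_free_eq0; last by rewrite /row_free ctr.
by rewrite -trmx0 (inj_eq trmx_inj) (negPf normal_neq0).
Qed.

(** [A^T *m beta] is the gradient of the drift. Height and drift thus have independent gradients,
    and fixing both cuts out a set of codimension 2. *)
Lemma rank_normal_drift : controllable A B ->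
  \rank (row_mx beta (A^T *m beta)) = 2%N.
Proof.
move=> ctr; set g := A^T *m beta.
rewrite -mxrank_tr tr_row_mx -addsmxE.
have sub : (beta^T < beta^T + g^T)%MS.
  rewrite ltmxE addsmxSl /= addsmx_sub submx_refl /=.
  apply/negP => /sub_rVP[lam] /(congr1 trmx); rewrite trmxK linearZ /= trmxK.
  exact: controllable_normal.
apply/eqP; rewrite eqn_leq; apply/andP; split.
  apply: leq_trans (mxrank_adds_leqif _ _) _.
  by rewrite -[2%N]/(1 + 1)%N leq_add // rank_leq_row.
have := rank_ltmx sub; rewrite {1}rank_rV.
by rewrite -trmx0 (inj_eq trmx_inj) normal_neq0.
Qed.

End Hypersurface.

(** * Finite sums and convex hulls *)

Lemma sum_continuous {R : realType} {T : topologicalType} {W : normedModType R}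
    (k : nat) (F : 'I_k -> T -> W) :
  (forall i, continuous (F i)) -> continuous (fun x => \sum_(i < k) F i x).
Proof. by move=> cF; apply: continuous_big => // z; exact: add_continuous. Qed.

Section Polytope.
Context {R : realType} {n : nat}.
Implicit Types (V : seq 'cV[R]_n) (g x : 'cV[R]_n).

Lemma mem_conv V i : (i < size V)%N -> Defs.conv V V`_i.
Proof.
move=> iV; exists (fun j => (j == Ordinal iV)%:R); split.
  by move=> j; rewrite ler0n.
split; rewrite (bigD1 (Ordinal iV)) //= eqxx.
  by rewrite big1 ?addr0 // => j /negPf ->.
by rewrite scale1r big1 ?addr0 // => j /negPf ->; rewrite scale0r.
Qed.

(** The point has barycentric weights [1 - s - r], [s], [r] in the triangle [c], [p], [q]; this is
    how planar curves are kept inside the polytope. *)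
Lemma conv_comb3 V c p q (s r : R) :
  Defs.conv V c -> Defs.conv V p -> Defs.conv V q ->
  0 <= s -> 0 <= r -> s + r <= 1 ->
  Defs.conv V (c + (s *: (p - c) + r *: (q - c))).
Proof.
move=> [wc [wc0 [wc1 ->]]] [wp [wp0 [wp1 ->]]] [wq [wq0 [wq1 ->]]] s0 r0 sr1.
exists (fun i => (1 - (s + r)) * wc i + s * wp i + r * wq i); split.
  by move=> i; rewrite !addr_ge0 ?mulr_ge0 ?subr_ge0.
split; first by rewrite !big_split /= -!mulr_sumr wc1 wp1 wq1; ring.
rewrite -!sumrB !scaler_sumr -!big_split /=; apply: eq_bigr => i _.
by rewrite -!scalerBl !scalerA -!scalerDl; congr (_ *: _); ring.
Qed.

Lemma conv_segment V c p (s : R) :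
  Defs.conv V c -> Defs.conv V p -> 0 <= s <= 1 ->
  Defs.conv V (c + s *: (p - c)).
Proof.
move=> Vc Vp /andP[s0 s1].
have := @conv_comb3 V c p c s 0 Vc Vp Vc s0 (lexx 0).
by rewrite scale0r !addr0; apply.
Qed.

Lemma conv_affine_le V g (k M : R) x : Defs.conv V x ->
  (forall i, (i < size V)%N -> bdot g V`_i + k <= M) -> bdot g x + k <= M.
Proof.
move=> [w [w0 [w1 ->]]] gM; rewrite linear_sum /=.
have -> : k = \sum_(i < size V) w i * k by rewrite -mulr_suml w1 mul1r.
rewrite -big_split /= -[M]mul1r -w1 mulr_suml ler_sum // => i _.
by rewrite linearZ -mulrDr ler_wpM2l ?w0 ?gM.
Qed.

(** The hull is the continuous image of the simplex of weights, which is compact as a closed part of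
    a cube. *)
Lemma conv_closed V : closed (Defs.conv V).
Proof.
set k := size V; set f := fun w : 'rV[R]_k => \sum_(i < k) w ord0 i *: V`_i.
have fc : continuous f.
  apply: sum_continuous => i w.
  exact: (@cvgZr_tmp _ _ _ _ (nbhs_filter w) (fun w : 'rV[R]_k => w ord0 i)
    _ _ (@coord_continuous _ _ _ ord0 i w)).
pose S := [set w : 'rV[R]_k | forall i, `[0, 1]%classic (w ord0 i)].
have Sc : compact S.
  apply: (@rV_compact R k (fun=> `[0, 1]%classic)) => i.
  exact: segment_compact.
pose H := [set w : 'rV[R]_k | \sum_(i < k) w ord0 i = 1].
have Hc : closed H.
  apply: (@preimage_closed _ _ (fun w : 'rV[R]_k => \sum_(i < k) w ord0 i)
    [set x | x = 1]); last exact: closed_eq.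
  move=> w _.
  exact: (@sum_continuous R _ _ k _ (fun i => @coord_continuous R 1 k ord0 i)).
have -> : Defs.conv V = f @` (S `&` H).
  apply/seteqP; split => [x [w [w0 [w1 ->]]]|_ [w [wS w1] <-]].
    exists (\row_i w i); last by apply: eq_bigr => i _; rewrite mxE.
    split; last by rewrite /H /=; under eq_bigr do rewrite mxE.
    move=> i /=; rewrite mxE in_itv /= w0 /= -w1 (bigD1 i) //= lerDl.
    by rewrite sumr_ge0.
  exists (fun i => w ord0 i); split; last by [].
  by move=> i; have := wS i; rewrite /= in_itv /= => /andP[].
apply: compact_closed; first exact: norm_hausdorff.
apply: continuous_compact; first exact: continuous_subspaceT.
exact: compact_closedI.
Qed.

(** [G] annihilates the rows of the matrix that defines [aff_dim], and two matrices with zero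
    product have ranks adding up to at most [n]. *)
Lemma rank_affine_hull V r (G : 'M[R]_(n, r)) :
  (forall i, (i < size V)%N -> G^T *m V`_i = G^T *m V`_0) ->
  (aff_dim V + \rank G <= n)%N.
Proof.
move=> GV; apply: mulmx0_rank_max; apply/row_matrixP => i.
rewrite row_mul rowK row0; apply: trmx_inj.
by rewrite trmx_mul trmxK trmx0 mulmxBr GV ?subrr.
Qed.

End Polytope.

(** * Derivatives and continuity of vector-valued maps *)

Section Derivatives.
Context {R : realType}.

Lemma is_derive_coord {m n} (M : R -> 'M[R]_(m, n)) (t : R)
    (dM : 'M[R]_(m, n)) i j :
  is_derive t 1 M dM -> is_derive t 1 (fun x => M x i j) (dM i j).
Proof.
move=> [Mt <-]; apply: DeriveDef; first exact: ((derivable_mxP M t 1).1 Mt).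
by rewrite derive_mx // mxE.
Qed.

Lemma is_derive_mx {m n} (M : R -> 'M[R]_(m, n)) (t : R) (dM : 'M[R]_(m, n)) :
  (forall i j, is_derive t 1 (fun x => M x i j) (dM i j)) -> is_derive t 1 M dM.
Proof.
move=> MdM; have Mt : derivable M t 1.
  by apply/derivable_mxP => i j; have [] := MdM i j.
apply: DeriveDef => //; rewrite derive_mx //; apply/matrixP => i j.
by rewrite mxE; have [_] := MdM i j.
Qed.

Lemma is_derive_bdot {n} (b : 'cV[R]_n) (M : R -> 'cV[R]_n) (t : R)
    (dM : 'cV[R]_n) :
  is_derive t 1 M dM -> is_derive t 1 (fun x => bdot b (M x)) (bdot b dM).
Proof.
move=> MdM; have -> : (fun x => bdot b (M x)) =
    \sum_(i < n) (b i 0 \*: (fun x => M x i 0)).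
  by apply/funext => x; rewrite /bdot fct_sumE.
by apply: is_derive_sum => i; apply: is_deriveZ; exact: is_derive_coord.
Qed.

Lemma is_derive_continuous {V : normedModType R} (f df : R -> V) :
  (forall t : R, is_derive t 1 f (df t)) -> continuous f.
Proof.
move=> fdf t; apply: differentiable_continuous; apply/derivable1_diffP.
by have [] := fdf t.
Qed.

Lemma is_derive_translate {V : normedModType R} (f : R -> V) (df : V)
    (t c : R) :
  is_derive (t - c) 1 f df -> is_derive t 1 (fun x => f (x - c)) df.
Proof.
move=> [fd <-].
have E : (fun h : R => h^-1 *: (((fun x => f (x - c)) \o shift t) (h *: 1) -
      f (t - c)))
    = (fun h => h^-1 *: ((f \o shift (t - c)) (h *: 1) - f (t - c))).
  by apply/funext => h /=; rewrite addrA.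
by apply: DeriveDef; rewrite /derivable /derive E.
Qed.

Lemma mulmx_continuous {m n} (M : 'M[R]_(m, n)) :
  continuous (fun x : 'cV[R]_n => M *m x).
Proof.
have -> : (fun x : 'cV[R]_n => M *m x) =
    (fun x => \sum_(j < n) x j ord0 *: col j M).
  apply/funext => x; apply/matrixP => i k; rewrite mxE summxE.
  by apply: eq_bigr => j _; rewrite !mxE mulrC (ord1 k).
apply: sum_continuous => j x.
exact: (@cvgZr_tmp _ _ _ _ (nbhs_filter x) (fun x : 'cV[R]_n => x j ord0)
    _ _ (@coord_continuous _ _ _ j ord0 x)).
Qed.

Lemma bdot_continuous {n} (b : 'cV[R]_n) : continuous (bdot b).
Proof.
have -> : bdot b = (fun x => \sum_(j < n) x j ord0 *: (b j ord0 : R^o)).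
  by apply/funext => x; apply: eq_bigr => i _; rewrite mulrC.
apply: (@sum_continuous R 'cV[R]_n R^o) => j x.
exact: (@cvgZr_tmp _ R^o _ _ (nbhs_filter x) (fun x : 'cV[R]_n => x j ord0)
    _ _ (@coord_continuous _ _ _ j ord0 x)).
Qed.

End Derivatives.

(** * Pieces of trajectories and their concatenation *)

Lemma partition_le {R : realType} (t : nat -> R) k :
  (forall i, (i < k)%N -> t i < t i.+1) ->
  forall i j, (i <= j)%N -> (j <= k)%N -> t i <= t j.
Proof.
move=> tlt i j; elim: j => [|j IHj]; first by rewrite leqn0 => /eqP ->.
rewrite leq_eqVlt => /predU1P[-> //|ij] jk.
by rewrite (le_trans (IHj ij (ltnW jk))) // ltW // tlt.
Qed.

Lemma partition_itv {R : realType} (t : nat -> R) k i s : t 0%N = 0 ->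
  (forall i, (i < k)%N -> t i < t i.+1) -> (i < k)%N -> t i < s < t i.+1 ->
  0 <= s <= t k.
Proof.
move=> t0 tlt ik /andP[/ltW ts /ltW st]; apply/andP; split.
  by rewrite -t0 (le_trans _ ts) // (partition_le tlt) // ltnW.
by rewrite (le_trans st) // (partition_le tlt).
Qed.

Section Arcs.
Context {R : realType} {n m : nat}.
Variables (A : 'M[R]_n) (a : 'cV[R]_n) (B : 'M[R]_(n, m)).
Implicit Types (Om : set 'cV[R]_n) (x y : 'cV[R]_n).

(** A single smooth piece. [0 < T] keeps partitions strictly increasing when pieces are prepended;
    asking for the equation on the whole line avoids one-sided derivatives at the ends. *)
Definition arc Om x y := exists (T : R) (u : R -> 'cV[R]_m)
    (phi : R -> 'cV[R]_n),
  [/\ 0 < T, continuous u, continuous phi,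
      (forall s : R, is_derive s 1 phi (A *m phi s + a + B *m u s)) &
      [/\ phi 0 = x, phi T = y & forall s, 0 <= s <= T -> Om (phi s)]].

(* Unlike in [reach], trajectories are continuous on the whole line; this makes
   their concatenation continuous by composition. *)
Definition greach Om Omf x := exists (T : R) (u : R -> 'cV[R]_m)
    (phi : R -> 'cV[R]_n) (k : nat) (t : nat -> R),
  [/\ 0 <= T /\ t 0%N = 0, t k = T,
      (forall i, (i < k)%N -> t i < t i.+1),
      (forall i, (i < k)%N -> exists g : R -> 'cV[R]_m,
          continuous g /\ (forall s, t i < s < t i.+1 -> g s = u s)) &
   [/\ phi 0 = x,
       continuous phi,
       (forall i (s : R), (i < k)%N -> t i < s < t i.+1 ->
          is_derive s 1 phi (A *m phi s + a + B *m u s)),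
       (forall s, 0 <= s <= T -> Om (phi s)) &
       Omf (phi T)]].

Lemma greach_reach Om Omf x : greach Om Omf x -> reach A a B Om Omf x.
Proof.
move=> [T [u [phi [k [t [T0 tk tlt gu [p0 pc pd pO pf]]]]]]].
exists T, u, phi, k, t; split => //.
  move=> i ik; have [g [gc gE]] := gu i ik; exists g; split => //.
  exact: continuous_subspaceT.
by split => //; exact: continuous_subspaceT.
Qed.

Lemma greach_refl Om Omf x : Om x -> Omf x -> greach Om Omf x.
Proof.
move=> Ox Ofx; exists 0, (cst 0), (cst x), 0%N, (fun=> 0); split => //.
by split => //; exact: cst_continuous.
Qed.

Lemma greach_arc Om Omf x y : arc Om x y -> greach Om Omf y -> greach Om Omf x.
Proof.
move=> [T0 [u0 [phi0 [T0_gt0 u0c p0c p0d [p00 p0T p0O]]]]].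
move=> [T [u [phi [k [t [[T_ge0 t0] tk tlt gu [p1x pc pd pO pf]]]]]]].
(* Each curve is frozen beyond the junction time [T0] by [min] or [max], so the sum is continuous by
   composition; subtracting [y] removes the junction value counted twice. *)
pose psi s := phi0 (Num.min s T0) + (phi (Num.max (s - T0) 0) - y).
have psi_l s : s <= T0 -> psi s = phi0 s.
  move=> sT; rewrite /psi (min_idPl sT).
  have -> : Num.max (s - T0) 0 = 0 by apply/max_idPr; rewrite subr_le0.
  by rewrite p1x subrr addr0.
have psi_r s : T0 <= s -> psi s = phi (s - T0).
  move=> sT; rewrite /psi (min_idPr sT) p0T.
  have -> : Num.max (s - T0) 0 = s - T0 by apply/max_idPl; rewrite subr_ge0.
  by rewrite addrC subrK.
have t_ge0 i : (i <= k)%N -> 0 <= t i.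
  by move=> ik; rewrite -t0 (partition_le tlt).
(* The old partition is shifted by [T0] and 0 is put in front; as [t 0 = 0], the first piece is
   exactly the arc. *)
exists (T0 + T), (fun s => if s < T0 then u0 s else u (s - T0)), psi, k.+1,
  (fun i => if i is j.+1 then T0 + t j else 0); split.
- by rewrite addr_ge0 // ltW.
- by rewrite tk.
- move=> [|i] ik; first by rewrite t0 addr0.
  by rewrite ltrD2l tlt.
- move=> [|i] ik.
    exists u0; split => // s /andP[_]; rewrite t0 addr0 => -> //.
  have [g [gc gE]] := gu i ik; exists (fun s => g (s - T0)); split.
    move=> s; apply: (@continuous_comp _ _ _ (fun s => s - T0) g);
      last exact: gc.
    by apply: cvgB; [exact: cvg_id|exact: cvg_cst].
  move=> s /andP[s1 s2]; rewrite ltNge (le_trans _ (ltW s1)) ?lerDl ?t_ge0 //=.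
    by rewrite gE // ltrBrDl s1 ltrBlDl s2.
  exact: ltnW.
- split.
  + by rewrite psi_l // ltW.
  + move=> s; apply: cvgD.
      apply: (@continuous_comp _ _ _ (fun s => Num.min s T0) phi0);
        last exact: p0c.
      by apply: continuous_min; [exact: cvg_id|exact: cvg_cst].
    apply: cvgB; last exact: cvg_cst.
    apply: (@continuous_comp _ _ _ (fun s => Num.max (s - T0) 0) phi);
      last exact: pc.
    apply: continuous_max; last exact: cvg_cst.
    by apply: cvgB; [exact: cvg_id|exact: cvg_cst].
  + move=> [|i] s ik.
      rewrite t0 addr0 => /andP[s0 sT]; rewrite sT psi_l ?(ltW sT) //.
      apply: near_eq_is_derive (p0d s).
      near=> z; apply/esym/psi_l/ltW; near: z; exact: lt_nbhsl.
    move=> /andP[s1 s2]; have sT : T0 < s.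
      by rewrite (le_lt_trans _ s1) // lerDl t_ge0 // ltnW.
    rewrite ltNge (ltW sT) /= psi_r ?(ltW sT) //.
    apply: (@near_eq_is_derive _ _ _ (fun z => phi (z - T0))).
      near=> z; apply/esym/psi_r/ltW; near: z; exact: lt_nbhsr.
    apply: is_derive_translate; apply: (pd i) => //.
    by rewrite ltrBrDl s1 ltrBlDl s2.
  + move=> s /andP[s0 sT]; have [sT0|/ltW sT0] := leP s T0.
      by rewrite psi_l //; apply: p0O; rewrite s0.
    by rewrite psi_r //; apply: pO; rewrite subr_ge0 sT0 lerBlDl.
  + by rewrite psi_r ?lerDl // addrAC subrr add0r.
Unshelve. all: by end_near. Qed.

End Arcs.

(** * Steering along prescribed curves *)

Section Steering.
Context {R : realType} {n m : nat}.
Variables (A : 'M[R]_n) (a : 'cV[R]_n) (B : 'M[R]_(n, m)) (beta : 'cV[R]_n).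
Hypotheses (rankB : (\rank B).+1 = n) (beta1 : bdot beta beta = 1)
  (betaB : forall y, Im_mx B y -> bdot beta y = 0).
Variable V : seq 'cV[R]_n.
Implicit Types (Om : set 'cV[R]_n) (c p q v w x y : 'cV[R]_n).

Local Notation P := (Defs.conv V).
Local Notation height := (bdot beta).
Local Notation drift x := (bdot beta (A *m x + a)).

Lemma height_comb3 c p q (s r : R) :
  height (c + (s *: (p - c) + r *: (q - c))) =
  height c + (s * (height p - height c) + r * (height q - height c)).
Proof. by rewrite !bdotD !bdotZ !bdotB. Qed.

Lemma drift_comb3 c p q (s r : R) :
  drift (c + (s *: (p - c) + r *: (q - c))) =
  drift c + (s * (drift p - drift c) + r * (drift q - drift c)).
Proof.
rewrite !mulmxDr -!scalemxAr !mulmxBr !bdotD !bdotZ !bdotB.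
ring.
Qed.

(** By the last hypothesis the velocity minus the uncontrolled field is orthogonal to [beta], so
    [Bpinv B] turns it into a control, continuous because the velocity is. *)
Lemma arc_curve Om c v w x y (s r ds dr : R -> R) (T : R) : 0 < T ->
  c + (s 0 *: v + r 0 *: w) = x -> c + (s T *: v + r T *: w) = y ->
  (forall t : R, is_derive t 1 s (ds t)) ->
  (forall t : R, is_derive t 1 r (dr t)) ->
  continuous ds -> continuous dr ->
  (forall t, 0 <= t <= T -> Om (c + (s t *: v + r t *: w))) ->
  (forall t, ds t * height v + dr t * height w =
    drift (c + (s t *: v + r t *: w))) ->
  arc A a B Om x y.
Proof.
move=> T_gt0 <- <- sd rd dsc drc curveO curveD.
pose phi (t : R) : 'cV[R]_n := c + (s t *: v + r t *: w).
pose dphi (t : R) : 'cV[R]_n := ds t *: v + dr t *: w.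
have phid (t : R) : is_derive t 1 phi (dphi t).
  apply: is_derive_mx => i j.
  have -> : (fun z : R => phi z i j) =
      cst (c i j) + (v i j \*: s + w i j \*: r).
    by apply/funext => z; rewrite !mxE /= [s z * _]mulrC [r z * _]mulrC.
  have -> : dphi t i j = 0 + (v i j *: ds t + w i j *: dr t).
    by rewrite !mxE add0r [v i j *: _]mulrC [w i j *: _]mulrC.
  by apply: is_deriveD; apply: is_deriveD; apply: is_deriveZ.
have phic : continuous phi := is_derive_continuous phid.
have dphic : continuous dphi.
  by move=> t; apply: cvgD; apply: cvgZr_tmp; [exact: dsc|exact: drc].
exists T, (fun t => Bpinv B *m (dphi t - (A *m phi t + a))), phi; split => //.
  move=> t.
  apply: (@continuous_comp _ _ _ (fun t => dphi t - (A *m phi t + a))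
    (mulmx (Bpinv B))); last exact: mulmx_continuous.
  apply: cvgB; first exact: dphic.
  apply: cvgD; last exact: cvg_cst.
  apply: (@continuous_comp _ _ _ phi (mulmx A)); first exact: phic.
  exact: mulmx_continuous.
move=> t; rewrite (mul_Bpinv rankB beta1 betaB).
  by rewrite addrC subrK; exact: phid.
apply/eqP; rewrite bdotB subr_eq0; apply/eqP.
by rewrite bdotD !bdotZ; exact: curveD.
Qed.

(** The drift is affine, hence zero on the whole segment, and so is the derivative of the height. *)
Lemma arc_level p q : P p -> P q -> drift p = 0 -> drift q = 0 ->
  height p = height q -> arc A a B P p q.
Proof.
move=> Pp Pq p0 q0 pq.
(* The null second direction [p - p] reduces the planar curve to a segment. *)
apply: (@arc_curve P p (q - p) (p - p) p q id (cst 0) (cst 1) (cst 0) 1 ltr01).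
- by rewrite /= !scale0r !addr0.
- by rewrite /= scale0r scale1r addr0 subrKC.
- exact: cst_continuous.
- exact: cst_continuous.
- by move=> t tI; rewrite /= scale0r addr0; exact: conv_segment.
- move=> t; rewrite drift_comb3 p0 q0 bdotB pq /=; ring.
Qed.

(* Along a segment the required speed is affine in the position, whence the
   exponential reparametrization. *)
Lemma arc_transit p q : P p -> P q -> drift p < 0 -> drift q < 0 ->
  height q < height p -> arc A a B P p q.
Proof.
move=> Pp Pq p0 q0 pq.
pose l1 := - drift p; pose l2 := - drift q; pose D := height p - height q.
have l1_gt0 : 0 < l1 by rewrite oppr_gt0.
have l2_gt0 : 0 < l2 by rewrite oppr_gt0.
have D_gt0 : 0 < D by rewrite subr_gt0.
(* [s] is the position on the segment: the rate of descent [ds t * D] must equal minus the drift,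
   which interpolates [l1] and [l2]. *)
suff [T [s [ds [T_gt0 sd dsc [s0 sT] [sI sE]]]]] :
    exists (T : R) (s ds : R -> R), [/\ 0 < T,
      (forall t : R, is_derive t 1 s (ds t)), continuous ds,
      s 0 = 0 /\ s T = 1 &
      (forall t, 0 <= t <= T -> 0 <= s t <= 1) /\
      forall t, ds t * D = l1 + s t * (l2 - l1)].
  apply: (@arc_curve P p (q - p) (p - p) p q s (cst 0) ds (cst 0) T) => //.
  - by rewrite s0 /= !scale0r !addr0.
  - by rewrite sT /= scale0r scale1r addr0 subrKC.
  - exact: cst_continuous.
  - move=> t tI; rewrite /= scale0r addr0; apply: conv_segment => //.
    exact: sI.
  - move=> t; rewrite drift_comb3 bdotB /= mul0r addr0 mul0r addr0.
    by apply: oppr_inj; rewrite -mulrN opprB sE /l1 /l2; ring.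
move: l1 l2 D l1_gt0 l2_gt0 D_gt0 => l1 l2 D l1_gt0 l2_gt0 D_gt0.
(* Equal speeds give a linear motion; the exponential formula would divide by zero. *)
have [l12|l12] := eqVneq l1 l2.
  exists (D / l1), (fun t => (l1 / D) * t), (cst (l1 / D)); split.
  - by rewrite divr_gt0.
  - move=> t; have -> : (fun t => l1 / D * t) = (l1 / D) \*: id by [].
    by apply: is_derive_eq; rewrite /GRing.scale /= mulr1.
  - exact: cst_continuous.
  - by split; [rewrite mulr0|field; rewrite !gt_eqF].
  - split=> [t /andP[t0 tT]|t]; last first.
      by rewrite /= l12 subrr mulr0 addr0 divfK // gt_eqF.
    apply/andP; split; first by rewrite mulr_ge0 // divr_ge0 // ltW.
    by rewrite mulrC -ler_pdivlMr ?divr_gt0 // mul1r invf_div.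
(* The solution starting at 0 reaches 1 when [expR (k * t) = l2 / l1]. This time is positive because
   [k] and [ln (l2 / l1)] have the same sign. *)
pose k := (l2 - l1) / D; pose e := l1 / (l2 - l1).
have l21 : l2 - l1 != 0 by rewrite subr_eq0 eq_sym.
exists (ln (l2 / l1) / k), (fun t => (expR (k * t) - 1) * e),
  (fun t => expR (k * t) * (l1 / D)).
have kT : k * (ln (l2 / l1) / k) = ln (l2 / l1).
  by rewrite mulrC divfK // mulf_neq0 // invr_neq0 // gt_eqF.
have T_gt0 : 0 < ln (l2 / l1) / k.
  have [lt12|lt21|] := ltgtP l1 l2; last by move/eqP: l12.
    apply: divr_gt0; first by rewrite ln_gt0 // ltr_pdivlMr // mul1r.
    by rewrite divr_gt0 // subr_gt0.
  rewrite -mulrNN -invrN; apply: mulr_gt0.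
    by rewrite oppr_gt0 ln_lt0 // divr_gt0 //= ltr_pdivrMr // mul1r.
  by rewrite invr_gt0 -mulNr opprB divr_gt0 // subr_gt0.
split => //.
- move=> t.
  have kd : is_derive t (1 : R) (k \*: id) k.
    by apply: is_derive_eq; rewrite /GRing.scale /= mulr1.
  have -> : (fun t => (expR (k * t) - 1) * e) =
      e \*: ((expR \o (k \*: id)) - cst 1).
    by apply/funext => z; rewrite mulrC.
  apply: is_derive_eq; rewrite /GRing.scale /= /e /k.
  by field; rewrite l21 gt_eqF.
- move=> t; apply: cvgM; last exact: cvg_cst.
  apply: (@continuous_comp _ _ _ (fun t => k * t) expR);
    last exact: continuous_expR.
  by apply: cvgM; [exact: cvg_cst|exact: cvg_id].
- rewrite mulr0 expR0 subrr mul0r kT lnK ?posrE ?divr_gt0 //.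
  by split => //; rewrite /e; field; rewrite l21 gt_eqF.
- split=> [t /andP[t0 tT]|t]; last by rewrite /e; field; rewrite l21 gt_eqF.
  have [lt12|lt21|] := ltgtP l1 l2; last by move/eqP: l12.
    have k_gt0 : 0 < k by rewrite divr_gt0 // subr_gt0.
    have E1 : 1 <= expR (k * t) by rewrite -expR0 ler_expR mulr_ge0 // ltW.
    have E2 : expR (k * t) <= l2 / l1.
      rewrite -[leRHS]lnK ?posrE ?divr_gt0 // ler_expR.
      by rewrite mulrC -ler_pdivlMr.
    have l21_gt0 : 0 < l2 - l1 by rewrite subr_gt0.
    apply/andP; split.
      by rewrite mulr_ge0 ?subr_ge0 // divr_ge0 // ltW.
    rewrite mulrA ler_pdivrMr // mul1r mulrBl mul1r lerD2r.
    by rewrite -ler_pdivlMr.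
  have k_lt0 : k < 0.
    by rewrite -oppr_gt0 -mulNr opprB divr_gt0 // subr_gt0.
  have E1 : expR (k * t) <= 1.
    by rewrite -expR0 ler_expR mulr_le0_ge0 // ltW.
  have E2 : l2 / l1 <= expR (k * t).
    rewrite -[leLHS]lnK ?posrE ?divr_gt0 // ler_expR.
    by rewrite [k * t]mulrC -ler_ndivlMr.
  have l12_gt0 : 0 < l1 - l2 by rewrite subr_gt0.
  have -> : (expR (k * t) - 1) * e = (1 - expR (k * t)) * (l1 / (l1 - l2)).
    by rewrite /e; field; rewrite l21 gt_eqF.
  apply/andP; split.
      by rewrite mulr_ge0 ?subr_ge0 // divr_ge0 // ltW.
  rewrite mulrA ler_pdivrMr // mul1r mulrBl mul1r lerD2l lerN2.
  by rewrite -ler_pdivrMr.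
Qed.

(** Provides the duration for [arc_leave]: the barycentric coordinates stay admissible and the total
    descent stays below [e]. *)
Lemma small_time (l1 l2 D e : R) : 0 < l1 -> 0 <= l2 -> 0 < D -> 0 < e ->
  exists T : R, [/\ 0 < T, T ^+ 2 * D < e &
    forall t, 0 <= t <= T -> 0 <= (2 * D * t - l2 * t ^+ 2) / l1 /\
      (2 * D * t - l2 * t ^+ 2) / l1 + t ^+ 2 <= 1].
Proof.
move=> l1_gt0 l2_ge0 D_gt0 e_gt0.
have l2_gt0 : 0 < l2 + 1 by rewrite ltr_wpDl.
have D4 : 0 < 4 * D by rewrite mulr_gt0.
have D2 : 0 < 2 * D by rewrite mulr_gt0.
(* The bounds give in turn [t ^+ 2 <= 2^-1], [2 * D * t <= l1 / 2], [l2 * t <= D] and, with the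
   first, [T ^+ 2 * D < e]. The 1 in [l2 + 1] covers [l2 = 0]. *)
exists (Num.min (Num.min 2^-1 (l1 / (4 * D)))
  (Num.min (D / (l2 + 1)) (e / (2 * D)))).
set T := Num.min _ _.
have : T <= T by []; rewrite {2}/T !le_min -!andbA => /and4P[T1 T2 T3 T4].
have T_gt0 : 0 < T by rewrite /T !lt_min !divr_gt0 // invr_gt0 ltr0n.
rewrite !ler_pdivlMr // in T2 T3 T4; clearbody T.
have TD : 0 < T * D by rewrite mulr_gt0.
have TTD : 0 <= (2^-1 - T) * (T * D) by rewrite mulr_ge0 ?subr_ge0 // ltW.
split => //; first by lra.
move=> t /andP[t0 tT].
have tD : 0 <= t * D by rewrite mulr_ge0 // ltW.
have tTD : 0 <= (T - t) * D by rewrite mulr_ge0 ?subr_ge0 // ltW.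
have tT2 : 0 <= (T - t) * (l2 + 1) by rewrite mulr_ge0 ?subr_ge0 // ltW.
have t2 : 0 <= t * (2^-1 - t).
  by rewrite mulr_ge0 // subr_ge0 (le_trans tT).
have tl2 : 0 <= t * (D - t * l2) by rewrite mulr_ge0 //; lra.
split; first by apply: divr_ge0; [lra|exact: ltW].
rewrite -lerBrDr ler_pdivrMr //.
have l1t : 0 <= l1 * (2^-1 - t ^+ 2).
  by apply: mulr_ge0; [exact: ltW|lra].
have l2t : 0 <= l2 * t ^+ 2 by rewrite mulr_ge0 // sqr_ge0.
lra.
Qed.

(** The height must start with speed zero, so it is made to fall as [t ^+ 2 * D]. The coefficient
    [s] towards [p] is chosen to make the drift equal to the required speed [- (2 * D * t)]. *)
Lemma arc_leave c p q (e : R) : P c -> P p -> P q -> drift c = 0 ->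
  drift p < 0 -> drift q <= 0 -> height p = height c -> height q < height c ->
  0 < e -> exists x, [/\ arc A a B P c x, P x, drift x < 0,
    height x < height c & height c - e < height x].
Proof.
move=> Pc Pp Pq c0 p0 q0 pc qc e0.
pose l1 := - drift p; pose l2 := - drift q; pose D := height c - height q.
have l1_gt0 : 0 < l1 by rewrite oppr_gt0.
have l2_ge0 : 0 <= l2 by rewrite oppr_ge0.
have D_gt0 : 0 < D by rewrite subr_gt0.
have [T [T_gt0 TD TI]] := small_time l1_gt0 l2_ge0 D_gt0 e0.
pose s t := (2 * D * t - l2 * t ^+ 2) / l1.
pose r (t : R) := t ^+ 2.
have sl1 z : z / l1 * - l1 = - z by rewrite mulrN divfK // gt_eqF.
have T2 : 0 < T ^+ 2 by rewrite exprn_gt0.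
exists (c + (s T *: (p - c) + r T *: (q - c))); split.
- apply: (@arc_curve P c (p - c) (q - c) c _ s r
    (fun t => (2 * D - 2 * l2 * t) / l1) (fun t => 2 * t) T T_gt0) => //.
  + have -> : s 0 = 0 by rewrite /s; ring.
    have -> : r 0 = 0 by rewrite /r; ring.
    by rewrite !scale0r !addr0.
  + move=> t.
    have -> : s = l1^-1 \*: ((2 * D) \*: id - l2 \*: (id ^+ 2)).
      by apply/funext => z; rewrite /s /= mulrC.
    apply: is_derive_eq; rewrite /GRing.scale /=; ring.
  + move=> t; have -> : r = id ^+ 2 by [].
    apply: is_derive_eq; rewrite /GRing.scale /=; ring.
  + move=> t; apply: cvgM; last exact: cvg_cst.
    apply: cvgB; first exact: cvg_cst.
    by apply: cvgM; [exact: cvg_cst|exact: cvg_id].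
  + by move=> t; apply: cvgM; [exact: cvg_cst|exact: cvg_id].
  + move=> t tI; have [] := TI t tI.
    by move=> *; apply: conv_comb3 => //; rewrite sqr_ge0.
  + move=> t; rewrite drift_comb3 c0 !bdotB pc !subr0 add0r.
    rewrite -[drift p]opprK -/l1 -[drift q]opprK -/l2 /s /r.
    rewrite -(opprB (height c) (height q)) -/D subrr mulr0 sl1.
    ring.
- have [] := TI T; first by rewrite lexx ltW.
  by move=> *; apply: conv_comb3 => //; rewrite sqr_ge0.
- rewrite drift_comb3 c0 !subr0 add0r.
  rewrite -[drift p]opprK -/l1 -[drift q]opprK -/l2 /s /r.
  rewrite sl1.
  have -> : - (2 * D * T - l2 * T ^+ 2) + T ^+ 2 * - l2 = - (2 * D * T) by ring.
  by rewrite oppr_lt0 !mulr_gt0.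
- rewrite height_comb3 pc subrr mulr0 add0r.
  rewrite -(opprB (height c) (height q)) -/D /r.
  by rewrite mulrN gtrBl mulr_gt0.
- rewrite height_comb3 pc subrr mulr0 add0r.
  rewrite -(opprB (height c) (height q)) -/D /r.
  by rewrite mulrN ltrD2l ltrN2.
Qed.

End Steering.

(** * Time reversal *)

Section Reversal.
Context {R : realType} {n m : nat}.
Variables (A : 'M[R]_n) (a : 'cV[R]_n) (B : 'M[R]_(n, m)).
Implicit Types (Om : set 'cV[R]_n) (x y c p q : 'cV[R]_n).

Lemma is_derive_reflect (f : R -> 'cV[R]_n) (df : 'cV[R]_n) (t T : R) :
  is_derive (T - t) 1 f df -> is_derive t 1 (fun s => f (T - s)) (- df).
Proof.
move=> fd; apply: is_derive_mx => i j.
have gd : is_derive t (1 : R) (fun s => T - s) (-1).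
  have -> : (fun s => T - s) = cst T - id by [].
  by apply: is_derive_eq; rewrite add0r.
have := @is_derive1_comp _ (fun z => f z i j) (fun s => T - s) t _ _
  (is_derive_coord i j fd) gd.
by rewrite mulrN1 mxE.
Qed.

(** Reversal negates the velocity; since [B] is kept, the control changes sign. *)
Lemma arc_rev Om x y : arc (- A) (- a) B Om x y -> arc A a B Om y x.
Proof.
move=> [T [u [phi [T0 uc pc pd [p0 pT pO]]]]].
have rc : continuous (fun s : R => T - s).
  by move=> s; apply: cvgB; [exact: cvg_cst|exact: cvg_id].
exists T, (fun s => - u (T - s)), (fun s => phi (T - s)); split.
- exact: T0.
- move=> s; apply: cvgN.
  by apply: (@continuous_comp _ _ _ (fun s : R => T - s) u);
    [exact: rc|exact: uc].
- move=> s.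
  by apply: (@continuous_comp _ _ _ (fun s : R => T - s) phi);
    [exact: rc|exact: pc].
- move=> s; have := is_derive_reflect (pd (T - s)).
  by rewrite mulNmx !opprD !opprK mulmxN.
- split; [by rewrite subr0|by rewrite subrr|move=> s /andP[s0 sT]].
  by apply: pO; rewrite subr_ge0 sT gerBl.
Qed.

(* Time reversal turns [(A, a, beta)] into [(-A, -a, -beta)], which leaves the
   drift unchanged, so that arrivals are reversed departures. *)
Lemma arc_arrive (beta : 'cV[R]_n) (V : seq 'cV[R]_n) c p q (e : R) :
  (\rank B).+1 = n -> bdot beta beta = 1 ->
  (forall y, Im_mx B y -> bdot beta y = 0) ->
  Defs.conv V c -> Defs.conv V p -> Defs.conv V q ->
  bdot beta (A *m c + a) = 0 -> bdot beta (A *m p + a) < 0 ->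
  bdot beta (A *m q + a) <= 0 ->
  bdot beta p = bdot beta c -> bdot beta c < bdot beta q -> 0 < e ->
  exists x, [/\ arc A a B (Defs.conv V) x c, Defs.conv V x,
    bdot beta (A *m x + a) < 0, bdot beta c < bdot beta x
    & bdot beta x < bdot beta c + e].
Proof.
move=> rankB beta1 betaB Vc Vp Vq c0 p0 q0 pc qc e0.
have bN z : bdot (- beta) z = - bdot beta z by rewrite bdotC bdotN bdotC.
have dN z : bdot (- beta) (- A *m z - a) = bdot beta (A *m z + a).
  by rewrite bN mulNmx -opprD bdotN opprK.
have [||||||||x [xc Vx x0]] :=
  @arc_leave R n m (- A) (- a) B (- beta) rankB _ _ V c p q e Vc Vp Vq;
  rewrite ?dN ?bN //.
- by rewrite bdotN opprK.
- by move=> y By; rewrite bN betaB // oppr0.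
- by rewrite pc.
- by rewrite ltrN2.
rewrite ltrN2 -opprD ltrN2 => cx xe.
by exists x; split => //; [exact: arc_rev|rewrite -dN].
Qed.

End Reversal.

(** * Monotonicity of the height along arbitrary trajectories *)

Section Trajectories.
Context {R : realType}.

(** Derivatives may fail to exist at partition points, so closed pieces are treated one at a time
    and glued by induction. *)
Lemma piecewise_nincr (h : R -> R) (t : nat -> R) k : t 0%N = 0 ->
  (forall i, (i < k)%N -> t i < t i.+1) ->
  {within `[0, t k], continuous h} ->
  (forall i (s : R), (i < k)%N -> t i < s < t i.+1 ->
    exists2 d, is_derive s 1 h d & d <= 0) ->
  forall x y, 0 <= x -> x <= y -> y <= t k -> h y <= h x.
Proof.
move=> t0 tlt hc hd.
have piece i x y : (i < k)%N -> t i <= x -> x <= y -> y <= t i.+1 -> h y <= h x.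
  move=> ik tx xy yt; apply: (@ler0_derive1_le_cc _ _ (t i) (t i.+1)) => //.
  - by move=> s; rewrite in_itv /= => /(hd i s ik)[d []].
  - move=> s; rewrite in_itv /= => /(hd i s ik)[d hsd d0].
    by rewrite derive1E; case: hsd => _ ->.
  - apply: continuous_subspaceW hc => s /=; rewrite !in_itv /= => /andP[s1 s2].
    have ti : 0 <= t i by rewrite -t0 (partition_le tlt) // ltnW.
    by rewrite (le_trans ti) // (le_trans s2) // (partition_le tlt).
  - by rewrite in_itv /= yt (le_trans tx).
  - by rewrite in_itv /= tx (le_trans xy).
suff main j : (j <= k)%N ->
    forall x y, 0 <= x -> x <= y -> y <= t j -> h y <= h x.
  exact: main.
elim: j => [|j IHj] jk x y x0 xy yt.
  suff -> : y = x by [].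
  by apply/eqP; rewrite eq_le xy andbT (le_trans yt) // t0.
have [ytj|tjy] := leP y (t j); first exact: (IHj (ltnW jk)).
have [xtj|tjx] := leP x (t j); last by apply: (piece j) => //; exact: ltW.
apply: (@le_trans _ _ (h (t j))); first by apply: (piece j) => //; exact: ltW.
by apply: (IHj (ltnW jk)).
Qed.

(** The equation holds only inside open pieces; values at the ends of the time interval are
    recovered as one-sided limits. *)
Lemma cvg_right_zero (f : R -> R) (a b : R) : a < b ->
  {within `[a, b], continuous f} -> forall c, a < c ->
  (forall s, a < s < c -> f s = 0) -> f a = 0.
Proof.
move=> ab /(continuous_within_itvP _ ab)[_ fa _] c ac f0.
apply: (cvg_unique (@norm_hausdorff _ _) fa).
apply: cvg_near_cst; near=> s; apply: f0; apply/andP; split.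
  by near: s; exact: nbhs_right_gt.
by near: s; exact: nbhs_right_lt.
Unshelve. all: by end_near. Qed.

Lemma cvg_left_zero (f : R -> R) (a b : R) : a < b ->
  {within `[a, b], continuous f} -> forall c, c < b ->
  (forall s, c < s < b -> f s = 0) -> f b = 0.
Proof.
move=> ab /(continuous_within_itvP _ ab)[_ _ fb] c cb f0.
apply: (cvg_unique (@norm_hausdorff _ _) fb).
apply: cvg_near_cst; near=> s; apply: f0; apply/andP; split.
  by near: s; exact: nbhs_left_gt.
by near: s; exact: nbhs_left_lt.
Unshelve. all: by end_near. Qed.

Lemma within_continuous_postcomp {T U W : topologicalType} (D : set T)
    (f : T -> U) (g : U -> W) : {within D, continuous f} -> continuous g ->
  {within D, continuous (fun x => g (f x))}.
Proof.
move=> fc gc x; apply: (@continuous_comp (subspace D) _ _ f g).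
  exact: fc.
exact: gc.
Qed.

Context {n m : nat}.
Variables (A : 'M[R]_n) (a : 'cV[R]_n) (B : 'M[R]_(n, m)) (beta : 'cV[R]_n).
Hypothesis betaB : forall y, Im_mx B y -> bdot beta y = 0.
Variables P F : set 'cV[R]_n.
Implicit Types x y : 'cV[R]_n.
Local Notation height := (bdot beta).
Local Notation drift x := (bdot beta (A *m x + a)).

Lemma is_derive_height (phi : R -> 'cV[R]_n) (v : 'cV[R]_m) (s : R) :
  is_derive s 1 phi (A *m phi s + a + B *m v) ->
  is_derive s 1 (fun z => height (phi z)) (drift (phi s)).
Proof.
move=> /(is_derive_bdot beta); rewrite (bdotD _ (A *m phi s + a)).
by rewrite (betaB (y := B *m v)) ?addr0 //; exists v.
Qed.

(** The height cannot increase and ends no lower than it started, so it is constant; its derivative,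
    the drift, vanishes on the open pieces and by continuity at both ends. *)
Lemma reach_level x : (forall y, P y -> drift y <= 0) ->
  reach A a B P F x -> ~ F x -> (forall y, F y -> height x <= height y) ->
  drift x = 0 /\ exists y, [/\ F y, height y = height x & drift y = 0].
Proof.
move=> driftP [T [u [phi [k [t [[T0 t0] tk tlt gu [p0 pc pd pP pF]]]]]]] nFx Fx.
(* An empty partition would mean [T = 0] and put [x] in [F]. *)
have k0 : (0 < k)%N.
  rewrite lt0n; apply/eqP => k0; apply: nFx.
  by move: pF; rewrite -tk k0 t0 p0.
have T_gt0 : 0 < T.
  rewrite -tk -t0 (lt_le_trans (tlt 0%N k0)) //.
  exact: (partition_le tlt).
have tI i s : (i < k)%N -> t i < s < t i.+1 -> 0 <= s <= T.
  by rewrite -tk; exact: partition_itv.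
have hd i s : (i < k)%N -> t i < s < t i.+1 ->
    is_derive s 1 (fun z => height (phi z)) (drift (phi s)).
  by move=> ik sI; apply: is_derive_height; exact: (pd i).
have hc : {within `[0, T], continuous (fun z => height (phi z))}.
  exact: (within_continuous_postcomp pc (@bdot_continuous _ _ beta)).
have dc : {within `[0, T], continuous (fun z => drift (phi z))}.
  apply: (within_continuous_postcomp (g := fun z => drift z) pc) => z.
  apply: (@continuous_comp _ _ _ (fun z => A *m z + a) (bdot beta)).
    exact: (cvgD (@mulmx_continuous R n n A z) (cvg_cst a)).
  exact: bdot_continuous.
have mono (r s : R) : 0 <= r -> r <= s -> s <= T ->
    height (phi s) <= height (phi r).
  rewrite -tk; apply: (@piecewise_nincr (fun z => height (phi z)) t k) => //.
    by rewrite tk.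
  move=> i {}s ik sI; exists (drift (phi s)); first exact: (hd i).
  by apply: driftP; apply: pP; exact: (tI i).
have hcst s : 0 <= s <= T -> height (phi s) = height x.
  move=> /andP[s0 sT]; apply/eqP; rewrite eq_le -{1}p0 mono //=.
  by rewrite (le_trans (Fx _ pF)) // mono.
have d0 i s : (i < k)%N -> t i < s < t i.+1 -> drift (phi s) = 0.
  move=> ik sI; have := hd i s ik sI => -[_ <-].
  have : is_derive s (1 : R) (fun z => height (phi z)) 0.
    apply: (@near_eq_is_derive _ _ _ (cst (height x))).
    have sI' : s \in `]t i, t i.+1[ by rewrite in_itv.
    near=> z; rewrite hcst //; apply: (tI i) => //.
    suff : z \in `]t i, t i.+1[ by rewrite in_itv.
    by near: z; exact: near_in_itvoo.
  by case.
split.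
  rewrite -p0; apply: (cvg_right_zero T_gt0 dc (c := t 1%N)).
    by rewrite -{1}t0 tlt.
  by move=> s; have := d0 0%N s k0; rewrite t0; exact.
exists (phi T); split => //; first by apply: hcst; rewrite lexx T0.
have k1 : (k.-1 < k)%N by rewrite prednK.
apply: (cvg_left_zero T_gt0 dc (c := t k.-1)).
  by have := tlt _ k1; rewrite prednK // tk.
by move=> s; have := d0 k.-1 s k1; rewrite prednK // tk; exact.
Unshelve. all: by end_near. Qed.

(* Gronwall: [exp (- C s) (M - height (phi s))] is nonincreasing. *)
Lemma reach_top x (M C : R) :
  (forall y, P y -> - drift y <= C * (M - height y)) ->
  M <= height x -> reach A a B P F x ->
  exists y, [/\ P y, F y & M <= height y].
Proof.
move=> driftC Mx [T [u [phi [k [t [[T0 t0] tk tlt gu [p0 pc pd pP pF]]]]]]].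
exists (phi T); split => //; first by apply: pP; rewrite lexx T0.
pose h s := expR (- C * s) * (M - height (phi s)).
have tI i s : (i < k)%N -> t i < s < t i.+1 -> 0 <= s <= T.
  by rewrite -tk; exact: partition_itv.
(* [h 0 = M - height x] is nonpositive, and the exponential factor of [h T] is positive. *)
suff : h T <= h 0.
  rewrite /h p0 mulr0 expR0 mul1r => hT.
  rewrite -subr_le0 -(pmulr_rle0 _ (expR_gt0 (- C * T))).
  by rewrite (le_trans hT) // subr_le0.
have hc : {within `[0, T], continuous (fun z => height (phi z))}.
  exact: (within_continuous_postcomp pc (@bdot_continuous _ _ beta)).
apply: (@piecewise_nincr h t k); rewrite ?tk //.
  move=> s; apply: cvgM; last by apply: cvgB; [exact: cvg_cst|exact: hc].
  apply: continuous_subspaceT => z.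
  apply: (@continuous_comp _ _ _ (fun z => - C * z) expR);
    last exact: continuous_expR.
  by apply: cvgM; [exact: cvg_cst|exact: cvg_id].
move=> i s ik sI.
have hd : is_derive s 1 (fun z => height (phi z)) (drift (phi s)).
  by apply: is_derive_height; exact: (pd i).
have ed : is_derive s 1 (fun z => expR (- C * z)) (expR (- C * s) * - C).
  apply: (@is_derive1_comp _ expR (fun z => - C * z)).
  have -> : (fun z => - C * z) = - C \*: id by [].
  by apply: is_derive_eq; rewrite /GRing.scale /= mulr1.
exists (expR (- C * s) * (- drift (phi s) - C * (M - height (phi s)))).
  have -> : h = (fun z => expR (- C * z)) *
    (cst M - (fun z => height (phi z))) by [].
  apply: is_derive_eq; rewrite /GRing.scale /= !fctE; ring.
rewrite pmulr_rle0 ?expR_gt0 // subr_le0 driftC //.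
by apply: pP; exact: (tI i).
Qed.

End Trajectories.

(** * Height and drift on a polytope *)

Section Geometry.
Context {R : realType} {n m : nat}.
Variables (A : 'M[R]_n) (a : 'cV[R]_n) (B : 'M[R]_(n, m)) (beta : 'cV[R]_n).
Variable V : seq 'cV[R]_n.
Implicit Types x y c p : 'cV[R]_n.
Local Notation P := (Defs.conv V).
Local Notation height := (bdot beta).
Local Notation drift x := (bdot beta (A *m x + a)).

Lemma driftE x : drift x = bdot (A^T *m beta) x + bdot beta a.
Proof. by rewrite bdotD bdot_mulmx. Qed.

Lemma height_segment c p (s : R) :
  height (c + s *: (p - c)) = height c + s * (height p - height c).
Proof. by rewrite bdotD bdotZ bdotB. Qed.

Lemma drift_segment c p (s : R) :
  drift (c + s *: (p - c)) = drift c + s * (drift p - drift c).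
Proof. by rewrite !driftE bdotD bdotZ bdotB; ring. Qed.

(** From [c0] one moves towards whichever of [lo], [hi] lies across the level of [x]. The level is
    met strictly before the end, where the affine drift is still negative. *)
Lemma level_drift c0 lo hi x : (forall y, P y -> drift y <= 0) ->
  P c0 -> drift c0 < 0 -> P lo -> P hi -> height lo < height x < height hi ->
  exists p, [/\ P p, height p = height x & drift p < 0].
Proof.
move=> driftP Pc0 dc0 Plo Phi /andP[lox xhi].
suff crossing e : P e -> (height c0 < height x < height e) ||
    (height e < height x < height c0) ->
    exists p, [/\ P p, height p = height x & drift p < 0].
  have [c0x|xc0|c0x] := ltgtP (height c0) (height x).
  - by apply: (crossing hi Phi); rewrite c0x xhi.
  - by apply: (crossing lo Plo); rewrite lox xc0 orbT.
  - by exists c0.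
move=> Pe ex; pose s := (height x - height c0) / (height e - height c0).
have ec0 : height e - height c0 != 0.
  case/orP: ex => /andP[h1 h2]; rewrite subr_eq0.
    by rewrite gt_eqF // (lt_trans h1).
  by rewrite lt_eqF // (lt_trans h1).
have /andP[s0 s1] : 0 <= s < 1.
  case/orP: ex => /andP[h1 h2]; rewrite /s.
    have h : 0 < height e - height c0 by rewrite subr_gt0 (lt_trans h1).
    rewrite ltr_pdivrMr // mul1r ltrD2r h2 andbT.
    by rewrite divr_ge0 // ?(ltW h) // subr_ge0 ltW.
  have h : 0 < height c0 - height e by rewrite subr_gt0 (lt_trans h1).
  rewrite -[X in X / _]opprB -[X in _ / X]opprB invrN mulrNN.
  rewrite ltr_pdivrMr // mul1r ltrD2l ltrN2 h1 andbT.
  by rewrite divr_ge0 // ?(ltW h) // subr_ge0 ltW.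
exists (c0 + s *: (e - c0)); split.
- by apply: conv_segment => //; rewrite s0 ltW.
- by rewrite height_segment /s divfK // addrC subrK.
- rewrite drift_segment.
  have -> : drift c0 + s * (drift e - drift c0) =
    (1 - s) * drift c0 + s * drift e by ring.
  rewrite ltr_wnDr ?mulr_ge0_le0 ?driftP //.
  by rewrite pmulr_rlt0 // subr_gt0.
Qed.

Lemma height_max : V <> [::] ->
  exists2 x, P x & forall y, P y -> height y <= height x.
Proof.
move=> V0; have sV : (0 < size V)%N by rewrite lt0n size_eq0; apply/eqP.
case: (@arg_maxP _ R _ (Ordinal sV) xpredT (fun i => height V`_i)) => //.
move=> i _ imax.
exists V`_i; first exact: mem_conv.
move=> y Vy; rewrite -[height y]addr0; apply: (conv_affine_le Vy) => j jV.
by rewrite addr0; exact: (imax (Ordinal jV)).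
Qed.

(* [P] being a polytope, the drift is controlled by the distance to the top
   face as soon as it vanishes there. *)
Lemma drift_top_bound (M : R) : (forall y, P y -> drift y <= 0) ->
  (forall y, P y -> height y <= M) ->
  (forall y, P y -> height y = M -> drift y = 0) ->
  exists C, forall y, P y -> - drift y <= C * (M - height y).
Proof.
move=> driftP topP dtop.
(* The sum dominates each ratio; vertices on the top face contribute 0, as division by zero yields
   0. *)
pose C := \sum_(i < size V) (- drift V`_i) / (M - height V`_i).
exists C => y Py; rewrite -subr_le0.
have E z : - drift z - C * (M - height z) =
    bdot (C *: beta - A^T *m beta) z + (- bdot beta a - C * M).
  rewrite driftE [bdot (_ - _) z]bdotC bdotB bdotZ.
  by rewrite !(bdotC z); ring.
rewrite E; apply: (conv_affine_le Py) => j jV; rewrite -E subr_le0.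
have Pj := mem_conv jV.
have [hj|hj] := eqVneq (height V`_j) M.
  by rewrite hj subrr mulr0 dtop // oppr0.
have hjM : 0 < M - height V`_j by rewrite subr_gt0 lt_neqAle hj topP.
rewrite -ler_pdivrMr // /C (bigD1 (Ordinal jV)) //= lerDl sumr_ge0 // => i _.
have Pi := mem_conv (ltn_ord i).
by rewrite divr_ge0 // ?oppr_ge0 ?subr_ge0 ?driftP ?topP.
Qed.

Lemma small_ratio (d e : R) : 0 <= d -> 0 < e ->
  exists s, [/\ 0 < s, s <= 1 & s * d < e].
Proof.
move=> d0 e0; have de : 0 < e + d by rewrite ltr_pwDl.
exists (e / (e + d)); split; first by rewrite divr_gt0.
  by rewrite ler_pdivrMr // mul1r lerDl.
by rewrite mulrAC ltr_pdivrMr // ltr_pM2l // ltrDr.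
Qed.

(** Otherwise the gradient of the drift would be orthogonal to a full-dimensional set, hence zero,
    making [beta] an eigenvector of [A^T] for 0. *)
Lemma drift_not_null : (\rank B).+1 = n -> controllable A B ->
  bdot beta beta = 1 -> (forall y, Im_mx B y -> bdot beta y = 0) ->
  (forall y, P y -> drift y <= 0) -> aff_dim V = n ->
  exists2 c, P c & drift c < 0.
Proof.
move=> rankB ctr beta1 betaB driftP dimV; apply: contrapT => nc.
have d0 x : P x -> drift x = 0.
  move=> Px; apply/eqP; rewrite eq_le driftP //= leNgt; apply/negP => dx.
  by apply: nc; exists x.
have := @rank_affine_hull _ _ V 1 (A^T *m beta).
rewrite dimV; set g := A^T *m beta.
have -> : \rank g = 1%N.
  rewrite -mxrank_tr rank_rV; have -> // : g^T != 0.
  rewrite -trmx0 (inj_eq trmx_inj); apply/eqP => g0.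
  by apply: (controllable_normal beta1 betaB (lam := 0) ctr); rewrite scale0r.
rewrite addn1 ltnn => H; apply: notF; apply: H => i iV.
have sV : (0 < size V)%N := leq_ltn_trans (leq0n i) iV.
apply/eqP; rewrite -subr_eq0 -mulmxBr; apply/eqP/bdot_eq0P.
have := d0 _ (mem_conv iV); have := d0 _ (mem_conv sV).
by rewrite !driftE -/g bdotB => h1 h2; lra.
Qed.

(** A set of dimension [n - 1] does not fit in one of codimension 2. *)
Lemma drift_height_not_const (k : R) : (\rank B).+1 = n -> controllable A B ->
  bdot beta beta = 1 -> (forall y, Im_mx B y -> bdot beta y = 0) ->
  aff_dim V = n.-1 ->
  ~ (forall x, P x -> drift x = 0 /\ height x = k).
Proof.
move=> rankB ctr beta1 betaB dimV cst.
have := @rank_affine_hull _ _ V (1 + 1) (row_mx beta (A^T *m beta)).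
have n0 : (0 < n)%N := leq_ltn_trans (leq0n _) (eq_leq rankB).
rewrite dimV (rank_normal_drift beta1 betaB ctr) addn2 prednK // ltnn => H.
apply: notF; apply: H => i iV.
have sV : (0 < size V)%N := leq_ltn_trans (leq0n i) iV.
have [di hi] := cst _ (mem_conv iV); have [d0 h0] := cst _ (mem_conv sV).
rewrite tr_row_mx !mul_col_mx; congr col_mx;
  apply/eqP; rewrite -subr_eq0 -mulmxBr; apply/eqP/bdot_eq0P.
  by rewrite bdotB hi h0 subrr.
by move: di d0; rewrite !driftE bdotB => h1 h2; lra.
Qed.

End Geometry.

(** * The equivalence *)

Unset Implicit Arguments. Set Strict Implicit.

Theorem theorem1 (R : realType) (n m : nat)
  (A : 'M[R]_n) (a : 'cV[R]_n) (B : 'M[R]_(n, m))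
  (P F : set 'cV[R]_n) (beta vminus vplus : 'cV[R]_n) :
  is_polytope P n ->
  (* (A1) rank B = n - 1 *)
  (\rank B).+1 = n ->
  (* (A2) *)
  controllable A B ->
  (* (A3) *)
  interior P `&` Oset A a B = set0 ->
  (* (A4) *)
  is_polytope F n.-1 ->
  F `<=` closure P `\` interior P ->
  (* beta : unit normal vector to Im B with beta^T (A x + a) <= 0 on P *)
  bdot beta beta = 1 ->
  (forall y, Im_mx B y -> bdot beta y = 0) ->
  (forall x, P x -> bdot beta (A *m x + a) <= 0) ->
  (* v^- in argmin, v^+ in argmax of beta^T x over F *)
  F vminus -> (forall x, F x -> bdot beta vminus <= bdot beta x) ->
  F vplus -> (forall x, F x -> bdot beta x <= bdot beta vplus) ->
  let Hminus := [set x | P x /\ bdot beta x <= bdot beta vminus] in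
  let Pplus := [set x | P x /\ forall y, P y -> bdot beta y <= bdot beta x] in
  let Bz := fun z => [set x : 'cV[R]_n | bdot beta x = bdot beta z] in
  let Bminus := if `[< Bz vminus `&` Oset A a B `&` F !=set0 >]
                then Bz vminus `&` Oset A a B else set0 in
  reach_set A a B P P F <->
  (Hminus `\` (F `|` Bminus) = set0 /\
   ~ (Pplus `<=` Oset A a B `&` [set x | P x /\ bdot beta vplus < bdot beta x])).
Proof.
move=> [VP [VP0 [-> dimP]]] {P} rankB ctr _ [VF [_ [FE dimF]]].
move=> FB beta1 betaB driftP Fvm vmin Fvp vmax Hm Pp Bz Bm.
set P := Defs.conv VP in FB driftP Hm Pp *.
have FP x : F x -> P x.
  by move=> /FB[]; rewrite -(closure_id P).1 //; exact: conv_closed.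
have OP x : Oset A a B x <-> bdot beta (A *m x + a) = 0.
  exact: Im_mxP.
have [c0 Pc0 dc0] := drift_not_null rankB ctr beta1 betaB driftP dimP.
split => [PF|[Ha Hb]].
  split.
    rewrite -subset0 => x [[Px hx]]; apply.
    have [xF|nxF] := pselect (F x); [by left|right].
    have Fx y : F y -> bdot beta x <= bdot beta y.
      by move=> Fy; rewrite (le_trans hx) ?vmin.
    have [dx [y [Fy hy dy]]] := reach_level betaB driftP (PF x Px) nxF Fx.
    have hxv : bdot beta x = bdot beta vminus.
      by apply/eqP; rewrite eq_le hx -hy vmin.
    rewrite /Bm; case: asboolP => [_|nB]; first by split; last exact/OP.
    by case: nB; exists y; split => //; split; [rewrite /Bz /= hy|exact/OP].
  (* If (b) fails, the top face lies in [O] and strictly above [F], yet a trajectory from it can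
     never lose height. *)
  move=> PpO; have [x Px xmax] := height_max beta VP0.
  have dtop y : P y -> bdot beta y = bdot beta x -> bdot beta (A *m y + a) = 0.
    move=> Py yx; apply/OP; have [] // := PpO y.
    by split => // z Pz; rewrite yx xmax.
  have [C driftC] := drift_top_bound driftP xmax dtop.
  have [y [Py Fy xy]] := reach_top betaB driftC (lexx _) (PF x Px).
  have [|_ [_]] := PpO y.
    by split => // z Pz; rewrite (le_trans (xmax z Pz)).
  by rewrite ltNge vmax.
have Fseg v f (s : R) : F v -> F f -> 0 <= s <= 1 -> F (v + s *: (f - v)).
  by rewrite FE; exact: conv_segment.
have vmP : P vminus := FP _ Fvm.
move=> x Px; apply: greach_reach.
(* Points of [H^-] are in [F] already, or by (a) in [Bm], where a level motion inside [O] leads to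
   [F]. *)
have [hx|hx] := leP (bdot beta x) (bdot beta vminus).
  have [xF|] : (F `|` Bm) x.
  - by apply: contrapT => nx; have : set0 x by rewrite -Ha.
  - exact: greach_refl.
  rewrite /Bm; case: asboolP => [[v [[hv Ov] Fv]] [hx' Ox]|_ []].
  apply: (greach_arc (y := v)); last by apply: greach_refl => //; exact: FP.
  apply: (arc_level rankB beta1 betaB) => //; [exact: FP|exact/OP|exact/OP|].
  by rewrite hv.
(* On a top face contained in [O], (b) forces [F] to touch that face, and a level motion reaches
   [vplus]. *)
have [[[_ xmax] PpO]|nPp] := pselect (Pp x /\ Pp `<=` Oset A a B).
  have hxp : bdot beta x <= bdot beta vplus.
    rewrite leNgt; apply/negP => hxp; apply: Hb => z Ppz.
    split; first exact: PpO.
    by case: (Ppz) => Pz zmax; split => //; rewrite (lt_le_trans hxp) ?zmax.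
  have Pvp := FP _ Fvp.
  have Ppvp : Pp vplus.
    by split => // z Pz; rewrite (le_trans (xmax z Pz)).
  apply: (greach_arc (y := vplus)); last exact: greach_refl.
  apply: (arc_level rankB beta1 betaB) => //; [apply/OP/PpO..|] => //.
  by apply/eqP; rewrite eq_le hxp xmax.
(* It remains to reach a point of negative drift strictly above [vminus], and to go from there to
   [F]. *)
suff [x1 [reach1 Px1 dx1 hx1]] : exists x1, [/\
    greach A a B P F x1 -> greach A a B P F x, P x1,
    bdot beta (A *m x1 + a) < 0 & bdot beta vminus < bdot beta x1].
  apply: reach1.
  have vme f : F f -> exists s, [/\ 0 < s, s <= 1 &
      s * (bdot beta f - bdot beta vminus) < bdot beta x1 - bdot beta vminus].
    by move=> Ff; apply: small_ratio; rewrite ?subr_ge0 ?subr_gt0 ?vmin.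
  (* If some [f] in [F] has negative drift, so do the points of [F] between it and [vminus]; one
     close enough to [vminus] lies below [x1]. *)
  have [[f Ff df]|nF] := pselect (exists2 f, F f & bdot beta (A *m f + a) < 0).
    have [s [s0 s1 sx1]] := vme f Ff.
    set p := vminus + s *: (f - vminus).
    have Fp : F p by apply: Fseg; rewrite // ltW.
    apply: (greach_arc (y := p)); last by apply: greach_refl => //; exact: FP.
    apply: (arc_transit rankB beta1 betaB) => //; first exact: FP.
      rewrite drift_segment; have := driftP _ vmP; move: df s0 s1.
      set d1 := bdot _ _; set d2 := bdot _ _; nra.
    by rewrite height_segment; lra.
  have dF y : F y -> bdot beta (A *m y + a) = 0.
    move=> Fy; apply/eqP; rewrite eq_le (driftP _ (FP _ Fy)) leNgt.
    apply/negP => dy.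
    by apply: nF; exists y.
  (* Now [F] lies in [O], so by controllability its height is not constant. A point [p] of [F]
     strictly between the levels of [vminus] and [x1] can then be entered from above. *)
  have [f Ff hf] : exists2 f, F f & bdot beta vminus < bdot beta f.
    apply: contrapT => nf.
    apply: (@drift_height_not_const _ _ _ A a B beta VF (bdot beta vminus));
      rewrite // => y; rewrite -FE => Fy; split; first exact: dF.
    apply/eqP; rewrite eq_le vmin // andbT leNgt; apply/negP => hy.
    by apply: nf; exists y.
  have [s [s0 s1 sx1]] := vme f Ff.
  set p := vminus + s *: (f - vminus).
  have Fp : F p by apply: Fseg; rewrite // ltW.
  have hp : bdot beta vminus < bdot beta p < bdot beta x1.
    rewrite height_segment ltrDl mulr_gt0 ?subr_gt0 //=; lra.
  have [w [Pw wp dw]] := level_drift driftP Pc0 dc0 vmP Px1 hp.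
  case/andP: hp => vp px1.
  (* This margin keeps the entry point [x2] below [x1], as the transit requires. *)
  have e0 : 0 < bdot beta x1 - bdot beta p by rewrite subr_gt0.
  have [x2 [x2p Px2 dx2 px2 x2x1]] := arc_arrive rankB beta1 betaB (FP _ Fp)
    Pw Px1 (dF _ Fp) dw (ltW dx1) wp px1 e0.
  rewrite addrC subrK in x2x1.
  apply: (greach_arc (y := x2)); last first.
    by apply: (greach_arc x2p); apply: greach_refl => //; exact: FP.
  exact: (arc_transit rankB beta1 betaB).
have [dx|dx] := ltP (bdot beta (A *m x + a)) 0; first by exists x; split.
have {}dx : bdot beta (A *m x + a) = 0 by apply/eqP; rewrite eq_le dx driftP.
(* Here [x] is in [O]. It is left with [vminus] as the lower target, and the margin keeps the new
   point above [vminus]. *)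
suff [p [Pp' px dp]] : exists p, [/\ P p, bdot beta p = bdot beta x &
    bdot beta (A *m p + a) < 0].
  have e0 : 0 < bdot beta x - bdot beta vminus by rewrite subr_gt0.
  have [x1 [xx1 Px1 dx1 _ hx1]] := arc_leave rankB beta1 betaB Px Pp' vmP dx dp
    (driftP _ vmP) px hx e0.
  exists x1; split => //; first exact: greach_arc.
  by rewrite opprB addrC subrK in hx1.
(* On the top face, [p] exists because that face is not contained in [O]; below it, [x] lies
   strictly between two levels of [P]. *)
have [Ppx|nPpx] := pselect (Pp x).
  apply: contrapT => np; apply: nPp; split => // z [Pz zmax]; apply/OP.
  apply/eqP; rewrite eq_le driftP //= leNgt; apply/negP => dz.
  apply: np; exists z; split => //.
  by case: Ppx => _ xmax; apply/eqP; rewrite eq_le xmax // zmax.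
have [hi Phi xhi] : exists2 hi, P hi & bdot beta x < bdot beta hi.
  apply: contrapT => nhi; apply: nPpx; split => // y Py.
  by rewrite leNgt; apply/negP => xy; apply: nhi; exists y.
by apply: (level_drift driftP Pc0 dc0 vmP Phi); rewrite hx.
Qed.
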